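(* The functors $(X,A,r)\mapsto DH_{n,r}(X,A)$ ($n\ge 0$, $r>0$), together with the connecting maps $\partial: DH_{n,r}(X,A)\to DH_{n-1,r}(A)$, form a discrete homology theory. That is, each $DH_{n,-}(-)$ is a functor from the category $Met$ to abelian groups, $\partial$ is a natural transformation, and the following hold for every $r>0$. (1) (Homotopy) If $f,g:(X,A)\to(Y,B)$ are $k$-Lipschitz maps of pairs that are discrete homotopic (as maps of pairs), then $f$ and $g$ induce the same map $DH_{n,r}(X,A)\to DH_{n,kr}(Y,B)$ for all $n$. (2) (Excision) If $\{A,B\}$ is a discrete cover of $X$ at scale $r$, then the inclusion $(B,A\cap B)\to(X,A)$ induces isomorphisms $DH_{n,r}(B,A\cap B)\to DH_{n,r}(X,A)$ for all $n$. (3) (Dimension) If $P$ is the one-point space, then $DH_{n,r}(P,\emptyset)=\{0\}$ for all $n\ge1$. (4) (Long exact sequence) For every metric space $X$ and subspace $A\subseteq X$, the inclusions $i:A\to X$ and $j:(X,\emptyset)\to(X,A)$ induce a long exact sequence $$\cdots\to DH_{n,r}(A)\xrightarrow{i_*}DH_{n,r}(X)\xrightarrow{j_*}DH_{n,r}(X,A)\xrightarrow{\partial_*}DH_{n-1,r}(A)\to\cdots.$$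
   Context: **Lipschitz maps.** For $r>0$, a map $f:X\to Y$ of metric spaces is $r$-Lipschitz if $d_Y(f(x_1),f(x_2))\le r\,d_X(x_1,x_2)$ for all $x_1,x_2\in X$. **Discrete homology at scale $r$.** Let $Q_n=\{0,1\}^n$ with the Hamming distance. A singular $(n,r)$-cube in a metric space $X$ is an $r$-Lipschitz map $\sigma:Q_n\to X$. Let $L_{n,r}(X)$ be the free abelian group on the singular $(n,r)$-cubes. For $n\ge1$ and $1\le i\le n$, the $i$-th front and back faces of $\sigma$ are the $(n-1,r)$-cubes $(A_i^n\sigma)(a_1,\dots,a_{n-1})=\sigma(a_1,\dots,a_{i-1},0,a_i,\dots,a_{n-1})$ and $(B_i^n\sigma)(a_1,\dots,a_{n-1})=\sigma(a_1,\dots,a_{i-1},1,a_i,\dots,a_{n-1})$. The cube $\sigma$ is degenerate if $A_i^n\sigma=B_i^n\sigma$ for some $i$. Let $D_{n,r}(X)$ be the subgroup generated by the degenerate cubes (so $D_{0,r}(X)=0$) and $C_{n,r}(X)=L_{n,r}(X)/D_{n,r}(X)$. The boundary $\partial\sigma=\sum_{i=1}^n(-1)^i(A_i^n\sigma-B_i^n\sigma)$ induces $\partial_n:C_{n,r}(X)\to C_{n-1,r}(X)$, making $C_{*,r}(X)$ a chain complex (zero in negative degrees), and $DH_{n,r}(X)=\ker\partial_n/\operatorname{Im}\partial_{n+1}$. For a subspace $A\subseteq X$, $C_{n,r}(X,A)=C_{n,r}(X)/C_{n,r}(A)$, and $DH_{n,r}(X,A)$ is the homology of this quotient complex; $DH_{n,r}(X,\emptyset)=DH_{n,r}(X)$.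 **Category $Met$.** Objects are triples $(X,Y,r)$ with $X$ a metric space, $Y\subseteq X$ a subspace, and $r$ a positive real number. Morphisms $(A,B,r)\to(X,Y,kr)$ are pairs $(f,k)$ with $f:A\to X$ a $k$-Lipschitz map such that $f(B)\subseteq Y$. Such a morphism induces $DH_{n,r}(A,B)\to DH_{n,kr}(X,Y)$ by $\sigma\mapsto f\circ\sigma$ on cubes. **Connecting map.** $\partial:DH_{n,r}(X,A)\to DH_{n-1,r}(A)$ sends the class of a relative cycle represented by a chain $\tau\in C_{n,r}(X)$ with $\partial\tau\in C_{n-1,r}(A)$ to $[\partial\tau]$. **Discrete homotopy.** Two $k$-Lipschitz maps $f,g:X\to Y$ are discrete homotopic ($k$-discrete homotopic) if there are an integer $m\ge0$ and a $k$-Lipschitz map $F:X\times\{0,\dots,m\}\to Y$ with $F(-,0)=f$ and $F(-,m)=g$, where $\{0,\dots,m\}$ has the metric $|a-b|$ and the product has the $\ell^1$-metric. For maps of pairs $(X,A)\to(Y,B)$ one requires in addition $F(A\times\{0,\dots,m\})\subseteq B$. **Discrete cover.** A discrete cover of $X$ at scale $r$ is a family $\{U_i\}$ of subsets of $X$ with $X=\bigcup U_i$ such that, for every $n$, every non-degenerate singular $(n,r)$-cube in $X$ has image contained in some $U_i$.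
   Formalization: In (1) Homotopy the scale is assumed to satisfy r ≥ 1: for r < 1 the claim fails, e.g. for X a point, Y = {0,k} and F(x,i) = ki, where the two constant maps are discrete homotopic but differ on DH_0. *)

(* Defs.v *)
From HB Require Import structures.
From mathcomp Require Import all_boot all_order all_algebra.
From mathcomp Require Import boolp classical_sets reals interval_inference.
From mathcomp Require Import topology.
From mathcomp Require Import zify.
From mathcomp.multinomials Require Import freeg.

Set Implicit Arguments.
Unset Strict Implicit.
Unset Printing Implicit Defensive.

Import Order.TTheory GRing.Theory Num.Theory.

Local Open Scope classical_set_scope.
Local Open Scope ring_scope.
Local Open Scope quotient_scope.

Definition mk_additive (U V : zmodType) (f : U -> V) (h : zmod_morphism f) :
  {additive U -> V} := HB.pack f (GRing.isZmodMorphism.Build U V f h).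

Definition is_subgroup (V : zmodType) (H : set V) : Prop :=
  H 0 /\ forall x y, H x -> H y -> H (x - y).

Definition generated (V : zmodType) (S : set V) : V -> bool :=
  fun x => `[< smallest (@is_subgroup V) S x >].

Lemma generated_closed (V : zmodType) (S : set V) :
  zmod_closed (generated S).
Proof.
split=> [|x y /asboolP hx /asboolP hy]; apply/asboolP => H [[H0 HB] SH] //.
by apply: (HB); [exact: hx | exact: hy].
Qed.

HB.instance Definition _ (V : zmodType) (S : set V) :=
  GRing.isZmodClosed.Build V (generated S) (generated_closed S).

Lemma generated_sub (V : zmodType) (S : set V) x : S x -> x \in generated S.
Proof. by move=> Sx; apply/asboolP => H [_]; apply. Qed.

Lemma generated_min (V : zmodType) (S H : set V) x :
  is_subgroup H -> S `<=` H -> x \in generated S -> H x.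
Proof. by move=> hH SH /asboolP; apply. Qed.

Lemma generated_range (U V : zmodType) (f : {additive U -> V}) y :
  reflect (range f y) (y \in generated (range f)).
Proof.
apply: (iffP idP) => [|h]; last exact: generated_sub.
apply: generated_min => //; split; first by exists 0; rewrite ?raddf0.
by move=> _ _ [a _ <-] [b _ <-]; exists (a - b); rewrite ?raddfB.
Qed.

Definition quotg (V : zmodType) (S : set V) : zmodType :=
  Quotient.quot (GRing.ZmodClosed.clone V (generated S) _).

Definition qproj (V : zmodType) (S : set V) : {additive V -> quotg S} :=
  \pi_(Quotient.quot (GRing.ZmodClosed.clone V (generated S) _)).

Lemma qprojP (V : zmodType) (S : set V) x y :
  reflect (qproj S x = qproj S y) (x - y \in generated S).
Proof. by rewrite Quotient.idealrBE; exact: eqP. Qed.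

Lemma qproj_eq0 (V : zmodType) (S : set V) x :
  reflect (qproj S x = 0) (x \in generated S).
Proof. by rewrite -[x]subr0 -(raddf0 (qproj S)) subr0; rewrite -{2}[x]subr0;
  exact: qprojP. Qed.

Lemma qproj_surj (V : zmodType) (S : set V) y : exists x, qproj S x = y.
Proof. by exists (repr y); rewrite /= reprK. Qed.

Section QuotientLift.
Variables (V W : zmodType) (S : set V) (f : {additive V -> W}).
Hypothesis fS : forall s, S s -> f s = 0.

Let qlift_fun (x : quotg S) : W := f (repr x).

Let qlift_funE x : qlift_fun (qproj S x) = f x.
Proof.
apply/eqP; rewrite -subr_eq0 -raddfB; apply/eqP.
apply: (@generated_min _ S [set v | f v = 0]) => //=.
- split=> [|a b /= ha hb]; first exact: raddf0.
  by rewrite raddfB ha hb subr0.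
- by apply/qprojP; rewrite /= reprK.
Qed.

Let qlift_additive : zmod_morphism qlift_fun.
Proof.
move=> x y; have [a <-] := qproj_surj x; have [b <-] := qproj_surj y.
by rewrite -raddfB !qlift_funE raddfB.
Qed.

Definition qlift : {additive quotg S -> W} := mk_additive qlift_additive.

Lemma qliftE x : qlift (qproj S x) = f x.
Proof. exact: qlift_funE. Qed.

End QuotientLift.

Record complex := Complex {
  chain :> nat -> zmodType;
  cbd : forall n, {additive chain n.+1 -> chain n};
  cbdK : forall n x, cbd n (cbd n.+1 x) = 0 }.

Arguments cbd {c n}.

Record chain_map (C D : complex) := ChainMap {
  cmap :> forall n, {additive C n -> D n};
  cmap_bd : forall n (x : C n.+1), cmap n (cbd x) = cbd (cmap n.+1 x) }.

(* Complexes are zero in negative degrees: in degree 0 all chains are cycles. *)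
Definition is_cycle (C : complex) n : C n -> bool :=
  match n with
  | 0 => fun _ => true
  | n'.+1 => fun x : C n'.+1 => cbd x == 0
  end.

Lemma is_cycle_closed (C : complex) n : zmod_closed (@is_cycle C n).
Proof.
case: n => [|n]; split=> //=; first by rewrite unfold_in /= raddf0.
by move=> x y; rewrite !unfold_in /= => /eqP hx /eqP hy; rewrite raddfB hx hy subr0.
Qed.

HB.instance Definition _ (C : complex) n :=
  GRing.isZmodClosed.Build (C n) (@is_cycle C n) (@is_cycle_closed C n).

Record chain_cycle (C : complex) n := Cycle {
  cycle_val :> C n;
  cycleP : cycle_val \in @is_cycle C n }.

HB.instance Definition _ C n := [isSub for @cycle_val C n].
HB.instance Definition _ C n := [Choice of @chain_cycle C n by <:].
HB.instance Definition _ C n := [SubChoice_isSubZmodule of @chain_cycle C n by <:].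

Definition boundaries (C : complex) n : set (chain_cycle C n) :=
  [set z | exists y : C n.+1, cbd y = val z].

Definition homology n (C : complex) : zmodType := quotg (@boundaries C n).

Definition hclass (C : complex) n : {additive chain_cycle C n -> homology n C} :=
  qproj (@boundaries C n).

Section HomologyMap.
Variables (C D : complex) (f : chain_map C D) (n : nat).

Lemma cmap_cycle (z : chain_cycle C n) : f n (val z) \in @is_cycle D n.
Proof.
case: z => z /=; case: n z => // m z; rewrite !unfold_in /= => /eqP hz.
by rewrite -cmap_bd hz raddf0.
Qed.

Let cycle_map_fun (z : chain_cycle C n) : chain_cycle D n := Cycle (cmap_cycle z).

Let cycle_map_additive : zmod_morphism cycle_map_fun.
Proof. by move=> x y; apply: val_inj; rewrite /= !raddfB. Qed.

Definition cycle_map : {additive chain_cycle C n -> chain_cycle D n} :=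
  mk_additive cycle_map_additive.

Let hclass_cycle_map : {additive chain_cycle C n -> homology n D} :=
  @hclass D n \o cycle_map.

Let hclass_cycle_map_bd z : boundaries z -> hclass_cycle_map z = 0.
Proof.
move=> [y hy]; apply/qproj_eq0/generated_sub.
by exists (f n.+1 y); rewrite /= -hy cmap_bd.
Qed.

Definition homology_map : {additive homology n C -> homology n D} :=
  qlift hclass_cycle_map_bd.

Lemma homology_mapE z : homology_map (hclass C n z) = hclass D n (cycle_map z).
Proof. exact: qliftE. Qed.

End HomologyMap.

Section QuotientComplex.
Variables (A X : complex) (i : chain_map A X).

Let qchain n : zmodType := quotg (range (i n)).

Let qproj_bd n : {additive X n.+1 -> qchain n} :=
  qproj (range (i n)) \o @cbd X n.

Let qproj_bd0 n s : range (i n.+1) s -> qproj_bd n s = 0.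
Proof.
move=> [a _ <-]; apply/qproj_eq0/generated_sub => /=.
by rewrite -cmap_bd; exists (cbd a).
Qed.

Let qbd n : {additive qchain n.+1 -> qchain n} := qlift (@qproj_bd0 n).

Let qbdK n x : qbd n (qbd n.+1 x) = 0.
Proof.
have [y <-] := qproj_surj x.
by rewrite /qbd !qliftE /= cbdK raddf0.
Qed.

Definition quot_complex : complex := Complex qbdK.

Lemma quot_proj_bd n (x : X n.+1) :
  qproj (range (i n)) (cbd x) =
  @cbd quot_complex n (qproj (range (i n.+1)) x).
Proof. exact/esym/(qliftE (@qproj_bd0 n)). Qed.

Definition quot_proj : chain_map X quot_complex :=
  @ChainMap X quot_complex (fun n => qproj (range (i n))) quot_proj_bd.

Hypothesis i_inj : forall n, injective (i n).

Definition connects n (z : homology n.+1 quot_complex) (y : homology n A) :=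
  exists (tau : X n.+1) (c : chain_cycle quot_complex n.+1) (a : chain_cycle A n),
    [/\ val c = quot_proj n.+1 tau, z = hclass _ _ c,
        cbd tau = i n (val a) & y = hclass _ _ a].

Lemma connects_total n z : exists y, @connects n z y.
Proof.
have [c <-] := qproj_surj z.
have [tau htau] := qproj_surj (val c).
have : range (i n) (cbd tau).
  apply/generated_range/qproj_eq0.
  rewrite quot_proj_bd htau; apply/eqP; exact: (cycleP c).
move=> [a _ ha].
have ca : a \in @is_cycle A n.
  case: n a tau {c htau z} ha => // n a tau ha.
  rewrite unfold_in /=; apply/eqP/(@i_inj n).
  by rewrite cmap_bd ha cbdK raddf0.
by exists (hclass _ _ (Cycle ca)), tau, c, (Cycle ca).
Qed.

Lemma connectsB n z z' y y' :
  @connects n z y -> connects z' y' -> connects (z - z') (y - y').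
Proof.
move=> [t [c [a [ct zc ta ya]]]] [t' [c' [a' [ct' zc' ta' ya']]]].
exists (t - t'), (c - c'), (a - a').
by split; rewrite /= ?raddfB ?ct ?ct' ?zc ?zc' ?ta ?ta' ?ya ?ya'.
Qed.

Lemma connects0 n y : @connects n 0 y -> y = 0.
Proof.
move=> [t [c [a [ct zc ta ->]]]].
have /(generated_min (H := @boundaries quot_complex n.+1)) : c \in generated (@boundaries quot_complex n.+1).
  by apply/qproj_eq0; rewrite -/(hclass _ _).
case=> //.
  split; first by exists 0; rewrite raddf0.
  by move=> u v [p hp] [q hq]; exists (p - q); rewrite !raddfB hp hq.
move=> w hw; have [u hu] := qproj_surj w.
have : range (i n.+1) (t - cbd u).
  apply/generated_range/qprojP; rewrite quot_proj_bd hu hw.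
  by rewrite ct.
move=> [b _ hb]; apply/qproj_eq0/generated_sub; exists b.
by apply: i_inj; rewrite cmap_bd hb raddfB cbdK subr0.
Qed.

Let connecting_fun n (z : homology n.+1 quot_complex) : homology n A :=
  projT1 (cid (connects_total z)).

Let connecting_additive n : zmod_morphism (@connecting_fun n).
Proof.
move=> z z'; rewrite /connecting_fun.
case: cid => y hy; case: cid => y1 h1; case: cid => y2 h2 /=.
apply/eqP; rewrite -subr_eq0; apply/eqP/connects0.
by rewrite -(subrr (z - z')); apply: connectsB => //; exact: connectsB.
Qed.

Definition connecting n : {additive homology n.+1 quot_complex -> homology n A} :=
  mk_additive (@connecting_additive n).

Lemma connectingE n (tau : X n.+1) (c : chain_cycle quot_complex n.+1)
    (a : chain_cycle A n) :
  val c = quot_proj n.+1 tau -> cbd tau = i n (val a) ->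
  connecting n (hclass _ _ c) = hclass _ _ a.
Proof.
move=> hc ha; rewrite /= /connecting_fun; case: cid => y hy /=.
apply/eqP; rewrite -subr_eq0; apply/eqP/connects0.
rewrite -(subrr (hclass _ _ c)); apply: connectsB => //.
by exists tau, c, a.
Qed.

End QuotientComplex.

Section QuotientComplexMap.
Variables (A X B Y : complex) (i : chain_map A X) (j : chain_map B Y).
Variables (g : chain_map A B) (f : chain_map X Y).
Hypothesis fij : forall n a, f n (i n a) = j n (g n a).

Let qf n : {additive X n -> quot_complex j n} := quot_proj j n \o f n.

Let qf0 n s : range (i n) s -> qf n s = 0.
Proof.
by move=> [a _ <-]; apply/qproj_eq0/generated_sub; rewrite fij; exists (g n a).
Qed.

Let qmap n : {additive quot_complex i n -> quot_complex j n} :=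
  qlift (@qf0 n).

Let qmap_bd n (x : quot_complex i n.+1) : qmap n (cbd x) = cbd (qmap n.+1 x).
Proof.
have [y <-] := qproj_surj x.
have E m z : qmap m (qproj _ z) = qproj (range (j m)) (f m z).
  exact: (qliftE (@qf0 m)).
rewrite -(quot_proj_bd i) !E cmap_bd; exact: quot_proj_bd.
Qed.

Definition quot_map : chain_map (quot_complex i) (quot_complex j) :=
  ChainMap qmap_bd.

Lemma quot_mapE n x : quot_map n (quot_proj i n x) = quot_proj j n (f n x).
Proof. exact: (qliftE (@qf0 n)). Qed.

End QuotientComplexMap.

Section FreeLift.
Variables (K : choiceType) (M : zmodType) (f : K -> M).

(* [zmodule M] is [M] with its structure of module over the integers *)
Let free_lift_fun (D : {freeg K}) : M := fglift (f : K -> zmodule M) D.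

Let free_lift_additive : zmod_morphism free_lift_fun.
Proof. exact: (@lift_is_additive int K (zmodule M) f). Qed.

Definition free_lift : {additive {freeg K} -> M} :=
  mk_additive free_lift_additive.

Lemma free_liftU k : free_lift << k >> = f k.
Proof. by rewrite /= /free_lift_fun liftU scale1r. Qed.

End FreeLift.

Lemma freeg_ind_additive (K : choiceType) (P : {freeg K} -> Prop) :
  is_subgroup [set x | P x] -> (forall k, P << k >>) -> forall x, P x.
Proof.
move=> [/= P0 PB] P1 x.
have PN y : P y -> P (- y) by move=> Py; rewrite -[- y]add0r; exact: PB.
have PD y z : P y -> P z -> P (y + z).
  by move=> Py Pz; rewrite -[z]opprK; apply: PB => //; exact: PN.
have PMn y n : P y -> P (y *+ n).
  by move=> Py; elim: n => [|n IH]; rewrite ?mulr0n // mulrS; exact: PD.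
rewrite -(freeg_sumE x); elim: (dom x) => [|k s IH]; first by rewrite big_nil.
rewrite big_cons; apply: PD => //; rewrite -[coeff k x]intz -freegU_mulz.
by case: (coeff k x) => n; [apply: PMn | apply/PN/PMn].
Qed.

Definition lipschitz (R : realType) (U V : Type) (dU : U -> U -> R)
    (dV : V -> V -> R) (k : R) (f : U -> V) : Prop :=
  forall x y, dV (f x) (f y) <= k * dU x y.

Section SubspaceMetric.
Variables (R : realType) (X : metricType R) (A : set X).

Let d (x y : A) : R := mdist (val x) (val y).

Let d_ge0 x y : 0 <= d x y. Proof. exact: mdist_ge0. Qed.

Let d_positivity x y : d x y = 0 -> x = y.
Proof. by move=> /mdist_positivity/val_inj. Qed.

Let ballE (x : A) e : ball x e = [set y | d x y < e].
Proof. by rewrite -[RHS]/(val @^-1` [set y | mdist (val x) y < e]) -ballEmdist. Qed.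

HB.instance Definition _ :=
  PseudoMetric_isMetric.Build R (set_type A) d_ge0 d_positivity ballE.

End SubspaceMetric.

Definition vertex n := {ffun 'I_n -> bool}.

Definition hamming n (x y : vertex n) : nat := #|[pred i | x i != y i]|.

(* [insert i b] sends [(a_0, ..., a_(n-1))] to
   [(a_0, ..., a_(i-1), b, a_i, ..., a_(n-1))]. *)
Definition insert n (i : 'I_n.+1) (b : bool) (a : vertex n) : vertex n.+1 :=
  [ffun j => if unlift i j is Some j' then a j' else b].

Section Cubes.
Variables (R : realType) (X : metricType R) (r : R).

Definition is_cube n (s : {ffun vertex n -> X}) : bool :=
  `[< lipschitz (fun x y => (hamming x y)%:R) (@mdist R X) r s >].

Record cube n := Cube {
  cube_fun :> {ffun vertex n -> X};
  cubeP : is_cube cube_fun }.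

HB.instance Definition _ n := [isSub for @cube_fun n].
HB.instance Definition _ n := [Choice of cube n by <:].

Lemma hamming_insert n i b (x y : vertex n) :
  hamming (insert i b x) (insert i b y) = hamming x y.
Proof.
rewrite /hamming -!sum1_card [LHS]big_mkcond [RHS]big_mkcond /=.
rewrite (bigD1_ord i) //= !inE !ffunE unlift_none eqxx add0n.
by apply: eq_bigr => j _; rewrite !inE !ffunE liftK.
Qed.

Definition face_fun n (i : 'I_n.+1) (b : bool) (s : {ffun vertex n.+1 -> X}) :
  {ffun vertex n -> X} := [ffun a => s (insert i b a)].

Lemma face_is_cube n (i : 'I_n.+1) b (s : cube n.+1) : is_cube (face_fun i b s).
Proof.
apply/asboolP => x y; rewrite !ffunE -(hamming_insert i b).
by have /asboolP := cubeP s; apply.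
Qed.

(* [face i false] is the front face in direction [i], [face i true] the back
   face. *)
Definition face n (i : 'I_n.+1) (b : bool) (s : cube n.+1) : cube n :=
  Cube (face_is_cube i b s).

Definition degenerate n : cube n -> Prop :=
  match n with
  | 0 => fun _ => False
  | n'.+1 => fun s : cube n'.+1 => exists i, face i false s = face i true s
  end.

Lemma faceE n (i : 'I_n.+1) b (s : cube n.+1) a :
  face i b s a = s (insert i b a).
Proof. by rewrite ffunE. Qed.

Lemma insert_insert n (i i' : 'I_n.+2) (j j' : 'I_n.+1) b c (a : vertex n) :
  fintype.lift i j = i' -> fintype.lift i' j' = i ->
  insert i b (insert j c a) = insert i' c (insert j' b a).
Proof.
move=> ij ji; apply/ffunP => k; rewrite !ffunE.
case: (unliftP i k) => [l|] ->; last first.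
  by rewrite -{1}ji liftK ffunE unlift_none.
case: (unliftP j l) => [m|] ->; last first.
  by rewrite ffunE unlift_none ij unlift_none.
have -> : fintype.lift i (fintype.lift j m) = fintype.lift i' (fintype.lift j' m).
  apply: val_inj; move: (congr1 val ij) (congr1 val ji); rewrite /= /bump.
  lia.
by rewrite liftK ffunE !liftK ffunE liftK.
Qed.

Lemma face_face n (i i' : 'I_n.+2) (j j' : 'I_n.+1) b c (s : cube n.+2) :
  fintype.lift i j = i' -> fintype.lift i' j' = i ->
  face j c (face i b s) = face j' b (face i' c s).
Proof.
move=> ij ji; apply: val_inj; apply/ffunP => a.
by rewrite /= !ffunE (insert_insert _ _ _ ij ji).
Qed.

(* Directions are numbered from 0 here, hence the exponent [i.+1]. *)
Definition boundary n (s : cube n.+1) : {freeg cube n} :=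
  \sum_(i < n.+1)
    (-1 : int) ^+ i.+1 *: (<< face i false s >> - << face i true s >>).

Definition degenerate_chains n : set {freeg cube n} :=
  [set x | exists2 s, degenerate s & x = << s >>].

Let lbd n : {additive {freeg cube n.+1} -> {freeg cube n}} :=
  free_lift (@boundary n).

Let boundaryE n (s : cube n.+1) : boundary s =
  \sum_(p : 'I_n.+1 * bool)
    (-1 : int) ^+ (p.1.+1 + p.2) *: << face p.1 p.2 s >>.
Proof.
rewrite -(pair_bigA _ (fun (i : 'I_n.+1) (b : bool) =>
  (-1 : int) ^+ (i.+1 + b) *: << face i b s >>)) /=.
apply: eq_bigr => i _; rewrite big_bool /= addn0 addn1.
by rewrite [RHS]addrC (exprS _ i.+1) mulN1r scaleNr scalerBr.
Qed.

Let swap n (p : ('I_n.+2 * bool) * ('I_n.+1 * bool)) :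
    ('I_n.+2 * bool) * ('I_n.+1 * bool) :=
  let i' := fintype.lift p.1.1 p.2.1 in
  ((i', p.2.2), (odflt ord0 (unlift i' p.1.1), p.1.2)).

Let swapP n (i : 'I_n.+2) (j : 'I_n.+1) :
  exists2 j', unlift (fintype.lift i j) i = Some j' &
              fintype.lift (fintype.lift i j) j' = i.
Proof.
case: (unliftP (fintype.lift i j) i) => [j' e|/eqP]; first by exists j'.
by rewrite (negbTE (neq_lift i j)).
Qed.

Let swapK n : involutive (@swap n).
Proof.
move=> [[i b] [j c]]; rewrite /swap /=.
by have [j' -> /= e] := swapP i j; rewrite e liftK.
Qed.

Let lbdK n x : lbd n (lbd n.+1 x) = 0.
Proof.
elim/freeg_ind_additive: x => [|s].
  split=> [|y z]; rewrite /mkset ?raddf0 // => hy hz.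
  by rewrite !raddfB hy hz subr0.
rewrite /lbd free_liftU boundaryE raddf_sum.
set S := (X in X = 0).
have SE : S = \sum_(p : ('I_n.+2 * bool) * ('I_n.+1 * bool))
    (-1 : int) ^+ (p.1.1.+1 + p.1.2 + (p.2.1.+1 + p.2.2)) *:
      << face p.2.1 p.2.2 (face p.1.1 p.1.2 s) >>.
  rewrite -(pair_bigA _ (fun (p : 'I_n.+2 * bool) (q : 'I_n.+1 * bool) =>
    (-1 : int) ^+ (p.1.+1 + p.2 + (q.1.+1 + q.2)) *:
      << face q.1 q.2 (face p.1 p.2 s) >>)) /=.
  apply: eq_bigr => p _; rewrite raddfZsign free_liftU boundaryE scaler_sumr.
  by apply: eq_bigr => q _; rewrite scalerA -exprD.
have SN : S = - S.
  rewrite {1}SE (reindex_inj (inv_inj (@swapK n))) SE -sumrN.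
  apply: eq_bigr => -[[i b] [j c]] _; rewrite /swap /=.
  have [j' -> /= e] := swapP i j.
  rewrite (face_face b c s erefl e) -scaleNr; congr (_ *: _).
  rewrite -signr_odd -[in RHS]signr_odd.
  have -> : odd ((fintype.lift i j).+1 + c + (j'.+1 + b)) =
            ~~ odd (i.+1 + b + (j.+1 + c)).
    have : val (fintype.lift (fintype.lift i j) j') = i by rewrite e.
    rewrite /= /bump; lia.
  by case: (odd _); rewrite ?opprK.
apply/eqP/freeg_eqP => k; rewrite coeff0.
have := congr1 (coeff k) SN; rewrite coeffN; lia.
Qed.

Definition cube_chain n : zmodType := quotg (@degenerate_chains n).

Let qlbd n : {additive {freeg cube n.+1} -> cube_chain n} :=
  qproj (@degenerate_chains n) \o lbd n.

Let qlbd0 n x : @degenerate_chains n.+1 x -> qlbd n x = 0.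
Proof.
move=> [s [i si] ->] {x}.
rewrite -[LHS]/(qproj _ (free_lift (@boundary n) << s >>)) free_liftU.
rewrite raddf_sum big1 // => k _.
set c := << _ >> - << _ >>.
suff c0 : qproj (@degenerate_chains n) c = 0.
  by rewrite -signr_odd scaler_sign; case: odd; rewrite ?raddfN c0 ?oppr0.
rewrite {}/c; case: (unliftP k i) => [j|] e; last by rewrite -e si subrr raddf0.
suff h b : qproj (@degenerate_chains n) << face k b s >> = 0.
  by rewrite raddfB !h subrr.
apply/qproj_eq0/generated_sub; exists (face k b s) => //.
case: n s i k j e si => [|n] s i k j e si; first by case: j e.
have [k' _ ek] := swapP k j; rewrite -e in ek.
by exists j; rewrite !(face_face b _ s (esym e) ek) si.
Qed.

Let qbd n : {additive cube_chain n.+1 -> cube_chain n} := qlift (@qlbd0 n).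

Let qbdK n x : qbd n (qbd n.+1 x) = 0.
Proof.
have [y <-] := qproj_surj x.
rewrite (qliftE (@qlbd0 n.+1)) (qliftE (@qlbd0 n)).
by rewrite -[LHS]/(qproj _ (lbd n (lbd n.+1 y))) lbdK raddf0.
Qed.

Definition cubes : complex := Complex qbdK.

Definition cube_class n (s : cube n) : cubes n :=
  qproj (@degenerate_chains n) << s >>.

Lemma cubes_bd n (s : cube n.+1) :
  cbd (cube_class s) = qproj (@degenerate_chains n) (boundary s).
Proof. rewrite [LHS](qliftE (@qlbd0 n)).
by rewrite -[LHS]/(qproj _ (free_lift (@boundary n) << s >>)) free_liftU. Qed.

Lemma cubes_ind n (P : cubes n -> Prop) :
  is_subgroup [set x | P x] -> (forall s, P (cube_class s)) -> forall x, P x.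
Proof.
move=> [/= P0 PB] Ps x; have [y <-] := qproj_surj x.
elim/freeg_ind_additive: y => [|s]; last exact: Ps.
by split=> [|y z]; rewrite /mkset ?raddf0 // raddfB; exact: PB.
Qed.

Lemma degenerate_coeff n (x : {freeg cube n}) :
  x \in generated (@degenerate_chains n) <->
  forall s, ~ degenerate s -> coeff s x = 0.
Proof.
split=> [xD s ns|xs].
  apply: (generated_min (H := [set x | coeff s x = 0]) _ _ xD).
    split=> [|y z]; rewrite /mkset ?coeff0 // => hy hz.
    by rewrite coeffB hy hz.
  move=> _ [t ht ->]; rewrite /mkset coeffU mul1r.
  by have [e|//] := eqVneq t s; rewrite e in ht.
rewrite -(freeg_sumE x); apply: rpred_sum => s _.
rewrite -[coeff s x]intz -freegU_mulz.
have [ds|ns] := pselect (degenerate s).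
  by apply: rpredMz; apply: generated_sub; exists s.
by rewrite xs // mulr0z rpred0.
Qed.

End Cubes.

Record met (R : realType) := Met {
  met_space : metricType R;
  met_sub : set met_space;
  met_scale : {posnum R} }.

Arguments met_sub {R} m _.

(* The codomain scale is constrained by [mfun_scale], not by the type, so that
   composites and identities typecheck without transport along
   [l * (k * r) = (l * k) * r] or [1 * r = r]. *)
Record metmor (R : realType) (P Q : met R) := MetMor {
  mfun :> met_space P -> met_space Q;
  mfactor : {posnum R};
  mfun_lipschitz : lipschitz (@mdist R _) (@mdist R _) mfactor%:num mfun;
  mfun_sub : forall x, met_sub P x -> met_sub Q (mfun x);
  mfun_scale : (met_scale Q)%:num = mfactor%:num * (met_scale P)%:num }.

Section MetCategory.
Variable R : realType.
Implicit Types P Q S : met R.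

Section Id.
Variable P : met R.

Let id_lipschitz :
  lipschitz (@mdist R (met_space P)) (@mdist R (met_space P)) (1%:pos : {posnum R})%:num id.
Proof. by move=> x y; rewrite mul1r. Qed.

Let id_scale : (met_scale P)%:num = (1%:pos : {posnum R})%:num * (met_scale P)%:num.
Proof. by rewrite mul1r. Qed.

Definition met_id : metmor P P := MetMor id_lipschitz (fun _ => id) id_scale.

End Id.

Section Comp.
Variables (P Q S : met R) (g : metmor Q S) (f : metmor P Q).

Let k : {posnum R} := ((mfactor g)%:num * (mfactor f)%:num)%:pos.

Let comp_lipschitz :
  lipschitz (@mdist R (met_space P)) (@mdist R (met_space S)) k%:num (g \o f).
Proof.
move=> x y; apply: (le_trans (mfun_lipschitz g _ _)).
by rewrite -mulrA ler_pM2l //; exact: mfun_lipschitz.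
Qed.

Let comp_sub x : met_sub P x -> met_sub S ((g \o f) x).
Proof. by move=> hx; exact/mfun_sub/mfun_sub. Qed.

Let comp_scale : (met_scale S)%:num = k%:num * (met_scale P)%:num.
Proof. by rewrite (mfun_scale g) (mfun_scale f) mulrA. Qed.

Definition met_comp : metmor P S := MetMor comp_lipschitz comp_sub comp_scale.

End Comp.

Section Isometry.
Variables (P Q : met R) (f : met_space P -> met_space Q).
Hypothesis f_isometry : forall x y, mdist (f x) (f y) = mdist x y.
Hypothesis f_sub : forall x, met_sub P x -> met_sub Q (f x).
Hypothesis f_scale : met_scale Q = met_scale P.

Let iso_lipschitz :
  lipschitz (@mdist R (met_space P)) (@mdist R (met_space Q)) (1%:pos : {posnum R})%:num f.
Proof. by move=> x y; rewrite mul1r f_isometry. Qed.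

Let iso_scale : (met_scale Q)%:num = (1%:pos : {posnum R})%:num * (met_scale P)%:num.
Proof. by rewrite mul1r f_scale. Qed.

Definition met_isometry : metmor P Q := MetMor iso_lipschitz f_sub iso_scale.

End Isometry.

(* [(X, A, r)] is sent to [(A, set0, r)] *)
Definition sub_obj P : met R := Met (met_space := met_sub P) set0 (met_scale P).

(* [(X, A, r)] is sent to [(X, set0, r)] *)
Definition abs_obj P : met R := Met (met_space := met_space P) set0 (met_scale P).

Definition sub_incl P : metmor (sub_obj P) (abs_obj P) :=
  @met_isometry (sub_obj P) (abs_obj P) val
    (fun _ _ => erefl) (fun _ h => h) erefl.

Definition pair_incl P : metmor (abs_obj P) P :=
  @met_isometry (abs_obj P) P id (fun _ _ => erefl) (fun _ => False_ind _) erefl.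

Section Restrict.
Variables (P Q : met R) (f : metmor P Q).

Let restrict_fun (x : met_sub P) : met_sub Q :=
  SigSub (mem_set (mfun_sub f (set_mem (valP x)))).

Let restrict_lipschitz :
  lipschitz (@mdist R (met_space (sub_obj P))) (@mdist R (met_space (sub_obj Q)))
    (mfactor f)%:num restrict_fun.
Proof. by move=> x y; exact: (mfun_lipschitz f). Qed.

Definition met_restrict : metmor (sub_obj P) (sub_obj Q) :=
  @MetMor R (sub_obj P) (sub_obj Q) restrict_fun (mfactor f) restrict_lipschitz
    (fun _ => False_ind _) (mfun_scale f).

End Restrict.

(* The inclusion of [(B, A `&` B)] in [(X, A)]; the subset of the space [B]
   given by [A `&` B] is the preimage of [A]. *)
Definition excision_incl (X : metricType R) (A B : set X) (r : {posnum R}) :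
  metmor (Met (met_space := B) (val @^-1` A) r) (Met A r) :=
  @met_isometry (Met (met_space := B) (val @^-1` A) r) (Met A r) val
    (fun _ _ => erefl) (fun _ h => h) erefl.

End MetCategory.

(* The subspace of the triple plays no role in [abs_cubes]. *)
Definition abs_cubes (R : realType) (P : met R) : complex :=
  cubes (met_space P) (met_scale P)%:num.

Section CubesMap.
Variables (R : realType) (P Q : met R) (f : metmor P Q).

Let cubeP_ n := cube (met_space P) (met_scale P)%:num n.
Let cubeQ_ n := cube (met_space Q) (met_scale Q)%:num n.

Lemma comp_is_cube n (s : cubeP_ n) :
  is_cube (met_scale Q)%:num [ffun a => f (s a)].
Proof.
apply/asboolP => x y; rewrite !ffunE.
apply: (le_trans (mfun_lipschitz f _ _)); rewrite (mfun_scale f) -mulrA ler_pM2l //.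
by have /asboolP := cubeP s; apply.
Qed.

Definition cube_comp n (s : cubeP_ n) : cubeQ_ n := Cube (comp_is_cube s).

Lemma face_comp n i b (s : cubeP_ n.+1) :
  face i b (cube_comp s) = cube_comp (face i b s).
Proof. by apply: val_inj; apply/ffunP => a; rewrite /= !ffunE. Qed.

Lemma degenerate_comp n (s : cubeP_ n) :
  degenerate s -> degenerate (cube_comp s).
Proof. by case: n s => // n s [i si]; exists i; rewrite !face_comp si. Qed.

Let push n : {additive {freeg cubeP_ n} -> abs_cubes Q n} :=
  free_lift (fun s => cube_class (cube_comp s)).

Let push0 n x : @degenerate_chains _ _ _ n x -> push n x = 0.
Proof.
move=> [s ds ->]; rewrite /push free_liftU; apply/qproj_eq0/generated_sub.
by exists (cube_comp s) => //; exact: degenerate_comp.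
Qed.

Let qpush n : {additive abs_cubes P n -> abs_cubes Q n} := qlift (@push0 n).

Let qpushE n (s : cubeP_ n) : qpush n (cube_class s) = cube_class (cube_comp s).
Proof. by rewrite [LHS](qliftE (@push0 n)) /push free_liftU. Qed.

Let qpush_bd n (x : abs_cubes P n.+1) : qpush n (cbd x) = cbd (qpush n.+1 x).
Proof.
elim/cubes_ind: x => [|s].
  split=> [|x y]; rewrite /mkset ?raddf0 // => hx hy.
  by rewrite !raddfB hx hy.
rewrite qpushE !cubes_bd /boundary !raddf_sum; apply: eq_bigr => i _.
rewrite -signr_odd !scaler_sign !face_comp.
have E b : qpush n (cube_class (face i b s)) =
           cube_class (cube_comp (face i b s)) by exact: qpushE.
by case: odd; rewrite ?raddfN !raddfB; rewrite -!/(cube_class _) !E.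
Qed.

Definition cubes_map : chain_map (abs_cubes P) (abs_cubes Q) :=
  ChainMap qpush_bd.

Lemma cubes_mapE n (s : cubeP_ n) :
  cubes_map n (cube_class s) = cube_class (cube_comp s).
Proof. exact: qpushE. Qed.

End CubesMap.

Lemma sub_cubes_map_inj (R : realType) (P : met R) n :
  injective (cubes_map (sub_incl P) n).
Proof.
pose r := (met_scale P)%:num.
have comp_inj : injective (@cube_comp _ _ _ (sub_incl P) n).
  move=> s t /(congr1 val) e; apply: val_inj; apply/ffunP => a.
  by apply: val_inj; move/ffunP: e => /(_ a); rewrite /= !ffunE.
have deg_inj s : degenerate (cube_comp (sub_incl P) s) -> @degenerate _ _ _ n s.
  case: n s {comp_inj} => // m s [i]; rewrite !face_comp => /(congr1 val) e.
  exists i; apply: val_inj; apply/ffunP => a.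
  by apply: val_inj; move/ffunP: e => /(_ a); rewrite /= !ffunE.
pose L : {additive _ -> {freeg cube (met_space P) r n}} :=
  free_lift (fun s => << cube_comp (sub_incl P) s >>).
have LE x : cubes_map (sub_incl P) n (qproj _ x) = qproj _ (L x).
  elim/freeg_ind_additive: x => [|s]; last first.
    by rewrite /L free_liftU; exact: cubes_mapE.
  split=> [|x y]; rewrite /mkset ?raddf0 // => hx hy.
  by rewrite !raddfB hx hy.
have Lcoeff x s : coeff (cube_comp (sub_incl P) s) (L x) = coeff s x.
  elim/freeg_ind_additive: x => [|t]; last first.
    by rewrite /L free_liftU !coeffU (inj_eq comp_inj).
  split=> [|x y]; first by rewrite /mkset raddf0 !coeff0.
  by rewrite /mkset => hx hy; rewrite raddfB !coeffB hx hy.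
apply: raddf_inj => z; have [x <-] := qproj_surj z.
rewrite LE => /qproj_eq0/degenerate_coeff hx.
apply/qproj_eq0/degenerate_coeff => s ns; rewrite -Lcoeff; apply: hx.
by move/deg_inj.
Qed.

Section DiscreteHomology.
Variable R : realType.
Implicit Types P Q : met R.

Definition pair_cubes P : complex := quot_complex (cubes_map (sub_incl P)).

Definition absDH n P : zmodType := homology n (abs_cubes P).

Definition DH n P : zmodType := homology n (pair_cubes P).

Lemma cubes_map_restrict P Q (f : metmor P Q) n a :
  cubes_map f n (cubes_map (sub_incl P) n a) =
  cubes_map (sub_incl Q) n (cubes_map (met_restrict f) n a).
Proof.
elim/cubes_ind: a => [|s].
  split=> [|x y]; rewrite /mkset ?raddf0 // => hx hy.
  by rewrite !raddfB hx hy.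
rewrite !cubes_mapE; congr cube_class; apply: val_inj; apply/ffunP => x.
by rewrite /= !ffunE.
Qed.

Definition pair_cubes_map P Q (f : metmor P Q) :
  chain_map (pair_cubes P) (pair_cubes Q) :=
  quot_map (cubes_map_restrict f).

Definition DH_map n P Q (f : metmor P Q) : {additive DH n P -> DH n Q} :=
  homology_map (pair_cubes_map f) n.

(* This identifies [DH_n(X)] with [DH_n(X, set0)], see [absDH_DH_bij]. *)
Definition absDH_DH n P : {additive absDH n P -> DH n (abs_obj P)} :=
  homology_map (quot_proj (cubes_map (sub_incl (abs_obj P)))) n.

Definition DH_conn n P : {additive DH n.+1 P -> DH n (sub_obj P)} :=
  @absDH_DH n (sub_obj P) \o connecting (@sub_cubes_map_inj R P) n.

Lemma DH_connE n P (tau : abs_cubes P n.+1) (c : chain_cycle (pair_cubes P) n.+1)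
    (a : chain_cycle (abs_cubes (sub_obj P)) n) :
  val c = quot_proj (cubes_map (sub_incl P)) n.+1 tau ->
  cbd tau = cubes_map (sub_incl P) n (val a) ->
  DH_conn n P (hclass _ _ c) = absDH_DH n (sub_obj P) (hclass _ _ a).
Proof. by move=> hc ha; rewrite -(connectingE (@sub_cubes_map_inj R P) hc ha). Qed.

Lemma absDH_DH_bij n P : bijective (absDH_DH n P).
Proof.
pose q : chain_map (abs_cubes P) (pair_cubes (abs_obj P)) :=
  quot_proj (cubes_map (sub_incl (abs_obj P))).
have sub0 m (a : abs_cubes (sub_obj (abs_obj P)) m) : a = 0.
  elim/cubes_ind: a => [|s].
    by split=> [//|x y]; rewrite /mkset => -> ->; rewrite subr0.
  by have := valP (s [ffun=> false]); rewrite in_set0.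
have q_inj m : injective (q m).
  apply: raddf_inj => x /qproj_eq0/generated_range[a _ <-].
  by rewrite (sub0 _ a) raddf0.
have inj : injective (absDH_DH n P).
  apply: raddf_inj => z; have [c <-] := qproj_surj z.
  rewrite [LHS](homology_mapE q) => /qproj_eq0 hc.
  have : boundaries (cycle_map q n c).
    apply: generated_min hc => //; split; first by exists 0; rewrite raddf0.
    by move=> x y [u hu] [v hv]; exists (u - v); rewrite !raddfB hu hv.
  move=> [y]; have [x <-] := qproj_surj y => hx.
  apply/qproj_eq0/generated_sub; exists x; apply: (q_inj n).
  by rewrite cmap_bd.
have surj y : exists x, absDH_DH n P x = y.
  have [c <-] := qproj_surj y; have [x hx] := qproj_surj (val c).
  have cx : x \in @is_cycle (abs_cubes P) n.
    case: n c x hx {inj y} => // m c x hx; rewrite unfold_in /=.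
    apply/eqP/(q_inj m); rewrite raddf0 [LHS](cmap_bd q) [q _ _]hx.
    exact/eqP/(cycleP c).
  exists (hclass _ _ (Cycle cx)); rewrite [LHS](homology_mapE q).
  by congr (hclass _ _ _); apply: val_inj; rewrite -hx.
exists (fun y => projT1 (cid (surj y))) => [x|y]; last by case: cid.
by apply: inj; case: cid.
Qed.

End DiscreteHomology.

Definition exact_at (U V W : zmodType) (f : U -> V) (g : V -> W) : Prop :=
  forall y, g y = 0 <-> exists x, f x = y.

(* The interval has unit steps, so [F (x, i)] and [F (x, i.+1)] are only known
   to be at distance at most [k]: they are the ends of a cube of scale [k * r]
   only when [1 <= r]. *)
Definition discrete_homotopic (R : realType) (X Y : metricType R) (k : R)
    (A : set X) (B : set Y) (f g : X -> Y) : Prop :=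
  exists m (F : X * 'I_m.+1 -> Y),
    [/\ lipschitz (fun x y : X * 'I_m.+1 =>
                      mdist x.1 y.1 + `|(x.2 : nat)%:R - (y.2 : nat)%:R|)
           (@mdist R Y) k F,
        forall x, F (x, ord0) = f x,
        forall x, F (x, ord_max) = g x &
        forall x i, A x -> B (F (x, i))].

Definition discrete_cover (R : realType) (X : metricType R) (r : R)
    (I : Type) (U : I -> set X) : Prop :=
  \bigcup_i U i = setT /\
  forall n (s : cube X r n), ~ degenerate s -> exists i, forall a, U i (s a).

(* Main.v *)
(* Everything but homotopy and excision is formal. Homotopy: when [1 <= r], two
   consecutive stages of a discrete homotopy span, over each cube [s], the cube
   [(t, a) |-> F (s a, i + t)] of one dimension more; these prisms form a chain
   homotopy, which respects subspaces and degenerate cubes. Excision: modulo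
   degenerate cubes and cubes in [A], every cube of [X] lies in [B], so the
   inclusion is already an isomorphism on relative chains. *)

Require Import Defs.
From mathcomp Require Import all_boot all_order all_algebra.
From mathcomp Require Import boolp classical_sets reals interval_inference.
From mathcomp Require Import topology.
From mathcomp.multinomials Require Import freeg.

Import Order.TTheory GRing.Theory Num.Theory.

Local Open Scope classical_set_scope.
Local Open Scope ring_scope.

Set Implicit Arguments.
Unset Strict Implicit.

(** * Homology classes and the maps induced on them *)

Lemma is_cycleS (C : complex) n (x : C n.+1) :
  (x \in @is_cycle C n.+1) = (cbd x == 0).
Proof. by []. Qed.

Lemma hclass_eq0 (C : complex) n (z : chain_cycle C n) :
  hclass C n z = 0 <-> exists y, cbd y = val z.
Proof.
split=> [/qproj_eq0 zB|zB]; last exact/qproj_eq0/generated_sub.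
apply: (generated_min (H := @boundaries C n)) zB => //.
split; first by exists 0; rewrite !raddf0.
by move=> x y [u hu] [v hv]; exists (u - v); rewrite !raddfB hu hv.
Qed.

Lemma hclass_surj (C : complex) n (x : homology n C) :
  exists z, hclass C n z = x.
Proof. exact: qproj_surj. Qed.

Lemma homology_map_hclass (C D : complex) (f : chain_map C D) n
    (z : chain_cycle C n) (w : chain_cycle D n) :
  f n (val z) = val w -> homology_map f n (hclass C n z) = hclass D n w.
Proof.
by move=> fzw; rewrite homology_mapE; congr (hclass _ _ _); exact: val_inj.
Qed.

Lemma homology_map_eq0 (C D : complex) (f : chain_map C D) n
    (z : chain_cycle C n) :
  homology_map f n (hclass C n z) = 0 <-> exists y, cbd y = f n (val z).
Proof. by rewrite homology_mapE; exact: hclass_eq0. Qed.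

Lemma homology_map_eq n (C D : complex) (f g : chain_map C D)
    (z : chain_cycle C n) :
  (exists y, cbd y = g n (val z) - f n (val z)) ->
  homology_map f n (hclass C n z) = homology_map g n (hclass C n z).
Proof.
move=> [y hy]; apply/esym/eqP.
rewrite !homology_mapE -subr_eq0 -raddfB; apply/eqP/hclass_eq0.
by exists y; rewrite hy raddfB.
Qed.

(** Degreewise inverses suffice: injectivity of [f] one degree lower shows that the preimage of a
    cycle is a cycle, and surjectivity one degree higher lifts a bounding chain. *)
Lemma homology_map_bij (C D : complex) (f : chain_map C D) :
  (forall n, bijective (f n)) -> forall n, bijective (homology_map f n).
Proof.
move=> f_bij n.
have fI m : injective (f m) := bij_inj (f_bij m).
have inj : injective (homology_map f n).
  apply: raddf_inj => x; have [z <-] := hclass_surj x.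
  move=> /homology_map_eq0[y]; have [g _ fg] := f_bij n.+1.
  rewrite -(fg y) -cmap_bd => /fI hy.
  by apply/hclass_eq0; exists (g y).
have surj y : exists x, homology_map f n x = y.
  have [w <-] := hclass_surj y; have [g _ fg] := f_bij n.
  have gw : g (val w) \in @is_cycle C n.
    case: n w g fg {inj y} => // m w g fg; rewrite is_cycleS.
    apply/eqP/(fI m); rewrite raddf0 cmap_bd fg.
    exact/eqP/(cycleP w).
  exists (hclass _ _ (Cycle gw)).
  by apply: homology_map_hclass; exact: fg.
exists (fun y => projT1 (cid (surj y))) => [x|y]; last by case: cid.
by apply: inj; case: cid.
Qed.

(** * The long exact sequence of a quotient complex, its naturality, and homotopies of quotients *)

Section QuotientExactness.
Variables (A X : complex) (i : chain_map A X).
Hypothesis i_inj : forall n, injective (i n).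

Lemma quot_proj_surj n y : exists x, quot_proj i n x = y.
Proof. exact: qproj_surj. Qed.

Lemma quot_proj_eq0 n x : quot_proj i n x = 0 <-> exists a, i n a = x.
Proof.
split=> [/qproj_eq0/generated_range[a _ <-]|[a <-]]; first by exists a.
by apply/qproj_eq0/generated_sub; exists a.
Qed.

(** The boundary of a lift of a relative cycle vanishes in the quotient, hence comes from [A]; its
    preimage is a cycle because [i] is injective and commutes with [cbd]. *)
Lemma quot_cycle_bd n (z : chain_cycle (quot_complex i) n.+1) (t : X n.+1) :
  quot_proj i n.+1 t = val z ->
  exists a : chain_cycle A n, cbd t = i n (val a).
Proof.
move=> ht; have [a ha] : exists a, i n a = cbd t.
  apply/quot_proj_eq0; rewrite cmap_bd ht; exact/eqP/(cycleP z).
suff ca : a \in @is_cycle A n by exists (Cycle ca).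
case: n a t z ht ha => // m a t z _ ha.
by rewrite is_cycleS; apply/eqP/(@i_inj m); rewrite cmap_bd ha cbdK raddf0.
Qed.

Lemma exact_quot_middle n :
  exact_at (homology_map i n) (homology_map (quot_proj i) n).
Proof.
move=> y; have [z <-] := hclass_surj y; split=> [|[x <-]]; last first.
  have [a <-] := hclass_surj x; rewrite homology_mapE.
  apply/homology_map_eq0; exists 0; rewrite raddf0; apply/esym/quot_proj_eq0.
  by exists (val a).
(* Lift the chain that bounds [z] in the quotient to [t] in [X]. Then [z - cbd t] is homologous to
   [z] and comes from [A]. *)
move=> /homology_map_eq0[q]; have [t <-] := quot_proj_surj q.
rewrite -cmap_bd => /esym/eqP; rewrite -subr_eq0 -raddfB.
move=> /eqP/quot_proj_eq0[a ha].
have ca : a \in @is_cycle A n.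
  case: n z a t ha {y q} => // m z a t ha.
  rewrite is_cycleS; apply/eqP/(@i_inj m).
  by rewrite cmap_bd ha raddfB cbdK subr0 raddf0; exact/eqP/(cycleP z).
exists (hclass _ _ (Cycle ca)); rewrite homology_mapE.
apply/eqP; rewrite -subr_eq0 -raddfB; apply/eqP/hclass_eq0; exists (- t).
by rewrite raddfB /= ha raddfN addrAC subrr sub0r.
Qed.

Lemma exact_quot_right n :
  exact_at (homology_map (quot_proj i) n.+1) (connecting i_inj n).
Proof.
move=> y; have [z <-] := hclass_surj y; split=> [|[x <-]]; last first.
  have [c <-] := hclass_surj x; rewrite homology_mapE.
  (* A cycle of [X] is its own lift and has zero boundary, so the connecting map returns the class
     of 0. *)
  rewrite (@connectingE _ _ _ i_inj n (val c) _ 0) ?raddf0 //.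
  exact/eqP/(cycleP c).
have [t ht] := quot_proj_surj (val z); have [a ha] := quot_cycle_bd ht.
rewrite (@connectingE _ _ _ i_inj n t _ a) // => /hclass_eq0[b hb].
(* Here [b] bounds [a] inside [A], so subtracting it from the lift [t] cancels the boundary without
   changing the relative class. *)
have ct : t - i n.+1 b \in @is_cycle X n.+1.
  by rewrite is_cycleS raddfB -cmap_bd hb -ha subrr.
exists (hclass _ _ (Cycle ct)); apply: homology_map_hclass.
rewrite [X in quot_proj _ _ X]/= raddfB -ht.
have -> : quot_proj i n.+1 (i n.+1 b) = 0 by apply/quot_proj_eq0; exists b.
by rewrite subr0.
Qed.

Lemma exact_quot_left n : exact_at (connecting i_inj n) (homology_map i n).
Proof.
move=> y; have [a <-] := hclass_surj y; split=> [|[x <-]]; last first.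
  have [z <-] := hclass_surj x; have [t ht] := quot_proj_surj (val z).
  have [b hb] := quot_cycle_bd ht.
  rewrite (@connectingE _ _ _ i_inj n t _ b) //.
  by apply/homology_map_eq0; exists t.
move=> /homology_map_eq0[t ht].
(* A chain of [X] that bounds [i a] is a relative cycle, and it witnesses that the connecting map
   hits the class of [a]. *)
have ct : quot_proj i n.+1 t \in @is_cycle (quot_complex i) n.+1.
  apply/eqP; rewrite -(cmap_bd (quot_proj i)) ht.
  by apply/quot_proj_eq0; exists (val a).
exists (hclass _ _ (Cycle ct)).
exact: (@connectingE _ _ _ i_inj n t _ a).
Qed.

(** Exactness at the right end, where the next term would have degree -1: every 0-chain is a cycle,
    so any lift represents a class. *)
Lemma homology_quot_proj0_surj y :
  exists x, homology_map (quot_proj i) 0 x = y.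
Proof.
have [z <-] := hclass_surj y; have [t ht] := quot_proj_surj (val z).
exists (hclass _ _ (@Cycle X 0 t isT)); exact: homology_map_hclass.
Qed.

End QuotientExactness.

(** If [t] lifts a relative cycle and has boundary [i a], then [f t] lifts its image and has
    boundary [j (g a)]. *)
Lemma connecting_natural (A X B Y : complex)
    (i : chain_map A X) (j : chain_map B Y)
    (i_inj : forall n, injective (i n)) (j_inj : forall n, injective (j n))
    (g : chain_map A B) (f : chain_map X Y)
    (fij : forall n a, f n (i n a) = j n (g n a)) n x :
  connecting j_inj n (homology_map (quot_map fij) n.+1 x) =
  homology_map g n (connecting i_inj n x).
Proof.
have [z <-] := hclass_surj x; have [t ht] := quot_proj_surj (val z).
have [a ha] := quot_cycle_bd i_inj ht.
rewrite (connectingE i_inj (esym ht) ha) !homology_mapE.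
apply: (connectingE j_inj (tau := f n.+1 t)); last by rewrite -cmap_bd ha fij.
by rewrite -(quot_mapE fij) ht.
Qed.

(** For a lift [t] of a relative cycle, [cbd t] comes from [A], so the term [h (cbd t)] dies modulo
    [B] and [h t] bounds the difference of the two images. Degree 0 is a separate hypothesis because
    there is no chain group in degree -1. *)
Lemma homology_quot_homotopic (A X B Y : complex)
    (i : chain_map A X) (j : chain_map B Y) (f g : chain_map X Y)
    (f' g' : chain_map A B) (h : forall n, X n -> Y n.+1)
    (fij : forall n a, f n (i n a) = j n (f' n a))
    (gij : forall n a, g n (i n a) = j n (g' n a)) :
  (forall x, cbd (h 0%N x) = g 0%N x - f 0%N x) ->
  (forall n x, cbd (h n.+1 x) = g n.+1 x - f n.+1 x - h n (cbd x)) ->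
  (forall n a, quot_proj j n.+1 (h n (i n a)) = 0) ->
  forall n x,
    homology_map (quot_map fij) n x = homology_map (quot_map gij) n x.
Proof.
move=> h0 hS hi n x; have [z <-] := hclass_surj x; apply: homology_map_eq.
have [t ht] := quot_proj_surj (val z); exists (quot_proj j n.+1 (h n t)).
rewrite -ht !quot_mapE -raddfB -[LHS](cmap_bd (quot_proj j)).
case: n t z {x} ht => [|n] t z ht; first by rewrite h0.
have [a ha] : exists a, i n a = cbd t.
  apply/quot_proj_eq0; rewrite cmap_bd ht; exact/eqP/(cycleP z).
by rewrite hS raddfB -ha hi subr0.
Qed.

Lemma bij_surj (U V : Type) (f : U -> V) :
  bijective f -> forall y, exists x, f x = y.
Proof. by move=> [g _ fg] y; exists (g y). Qed.

(** Exactness is proved for homology of absolute chains; this carries it along the comparison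
    [absDH_DH] to the groups [DH]. *)
Lemma exact_at_bij (U V W U' V' W' : zmodType)
    (f : U -> V) (g : V -> W) (f' : U' -> V') (g' : {additive V' -> W'})
    (u : U -> U') (v : V -> V') (w : {additive W -> W'}) :
  (forall x, f' (u x) = v (f x)) -> (forall x, g' (v x) = w (g x)) ->
  bijective u -> bijective v -> injective w ->
  exact_at f g -> exact_at f' g'.
Proof.
move=> fu gv u_bij v_bij w_inj E y.
have [x <-] := bij_surj v_bij y; rewrite gv; split=> [|[x' hx']].
  rewrite -[RHS](raddf0 w) => /w_inj/E[x' <-].
  by exists (u x').
have [x'' hx''] := bij_surj u_bij x'; rewrite -(raddf0 w); apply: congr1.
by apply/E; exists x''; apply: (bij_inj v_bij); rewrite -fu hx''.
Qed.

(** * Functoriality of [DH], naturality of the connecting map and the long exact sequence *)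

Section Functoriality.
Variable R : realType.
Implicit Types P Q S : met R.

Lemma cubes_class_ext P n (C : zmodType) (f g : {additive abs_cubes P n -> C}) :
  (forall s : cube (met_space P) (met_scale P)%:num n,
     f (cube_class s) = g (cube_class s)) ->
  f =1 g.
Proof.
move=> fg; elim/cubes_ind=> [|s]; last exact: fg.
split=> [|x y]; rewrite /mkset ?raddf0 // => hx hy.
by rewrite !raddfB hx hy.
Qed.

Lemma homology_ext n (C D : complex) (f g : chain_map C D) :
  f n =1 g n -> homology_map f n =1 homology_map g n.
Proof.
move=> fg x; have [z <-] := hclass_surj x; rewrite (homology_mapE g).
by apply: homology_map_hclass; exact: fg.
Qed.

Lemma homology_map_comp n (C D E : complex) (f : chain_map C D)
    (g : chain_map D E) (h : chain_map C E) :
  (forall x, h n x = g n (f n x)) ->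
  forall x, homology_map h n x = homology_map g n (homology_map f n x).
Proof.
move=> hgf x; have [z <-] := hclass_surj x.
rewrite (homology_mapE f z) (homology_mapE g).
by apply: homology_map_hclass; exact: hgf.
Qed.

Lemma homology_map_square n (C D C' D' : complex) (f : chain_map C D)
    (f' : chain_map C' D') (g : chain_map C C') (g' : chain_map D D') :
  (forall x, f' n (g n x) = g' n (f n x)) ->
  forall x,
    homology_map f' n (homology_map g n x) =
    homology_map g' n (homology_map f n x).
Proof.
move=> sq x; have [z <-] := hclass_surj x.
rewrite (homology_mapE g z) (homology_mapE f z) (homology_mapE g').
by apply: homology_map_hclass; exact: sq.
Qed.

Lemma pair_cubes_mapE P Q (f : metmor P Q) n x :
  pair_cubes_map f n (quot_proj (cubes_map (sub_incl P)) n x) =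
  quot_proj (cubes_map (sub_incl Q)) n (cubes_map f n x).
Proof. exact: quot_mapE. Qed.

Lemma cubes_map_ext P Q (f g : metmor P Q) n :
  f =1 g -> cubes_map f n =1 cubes_map g n.
Proof.
move=> fg; apply: cubes_class_ext => s; rewrite !cubes_mapE.
by congr cube_class; apply: val_inj; apply/ffunP => a; rewrite !ffunE.
Qed.

Lemma cubes_map_id P n (f : metmor P P) : f =1 id -> cubes_map f n =1 id.
Proof.
move=> f1; apply: (cubes_class_ext (g := idfun)) => s; rewrite cubes_mapE.
by congr cube_class; apply: val_inj; apply/ffunP => a; rewrite !ffunE f1.
Qed.

Lemma cubes_map_comp P Q S (g : metmor Q S) (f : metmor P Q) n x :
  cubes_map (met_comp g f) n x = cubes_map g n (cubes_map f n x).
Proof.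
apply: (cubes_class_ext (g := cubes_map g n \o cubes_map f n)) => s.
rewrite -[RHS]/(cubes_map g n (cubes_map f n (cube_class s))) !cubes_mapE.
by congr cube_class; apply: val_inj; apply/ffunP => a; rewrite !ffunE.
Qed.

(** Lets the end stages of a homotopy be identified with the given maps, which they equal only
    pointwise. *)
Lemma DH_map_ext n P Q (f g : metmor P Q) :
  f =1 g -> DH_map n f =1 DH_map n g.
Proof.
move=> fg; apply: homology_ext => x; have [t <-] := quot_proj_surj x.
by rewrite !pair_cubes_mapE (cubes_map_ext fg).
Qed.

Lemma DH_map_id n P x : DH_map n (met_id P) x = x.
Proof.
have [z <-] := hclass_surj x; apply: homology_map_hclass.
have [t <-] := quot_proj_surj (val z).
by rewrite pair_cubes_mapE cubes_map_id.
Qed.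

Lemma DH_map_comp n P Q S (g : metmor Q S) (f : metmor P Q) x :
  DH_map n (met_comp g f) x = DH_map n g (DH_map n f x).
Proof.
apply: homology_map_comp => y; have [t <-] := quot_proj_surj y.
by rewrite !pair_cubes_mapE cubes_map_comp.
Qed.

Lemma absDH_DH_natural n P Q (f : metmor (abs_obj P) (abs_obj Q)) x :
  DH_map n f (absDH_DH n P x) =
  absDH_DH n Q
    (homology_map (cubes_map f : chain_map (abs_cubes P) (abs_cubes Q)) n x).
Proof.
apply: homology_map_square => y.
exact: (@pair_cubes_mapE (abs_obj P) (abs_obj Q) f).
Qed.

Lemma DH_conn_natural n P Q (f : metmor P Q) x :
  DH_conn n Q (DH_map n.+1 f x) = DH_map n (met_restrict f) (DH_conn n P x).
Proof.
(* Since [abs_obj (sub_obj P)] is convertible to [sub_obj P], the comparison is natural for the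
   restricted map; what remains is naturality of [connecting]. *)
rewrite [RHS](absDH_DH_natural (P := sub_obj P) (Q := sub_obj Q)).
apply: (congr1 (absDH_DH n (sub_obj Q))); exact: connecting_natural.
Qed.

Lemma cubes_map_pair_incl n P (x : abs_cubes P n) :
  cubes_map (pair_incl P) n x = x.
Proof.
apply: (cubes_class_ext (f := cubes_map (pair_incl P) n) (g := idfun)) => s.
rewrite cubes_mapE.
by congr cube_class; apply: val_inj; apply/ffunP => a; rewrite !ffunE.
Qed.

(** Under the comparison [absDH_DH], the inclusion of pairs becomes the projection of chains onto
    the quotient complex. *)
Lemma DH_map_pair_incl n P x :
  DH_map n (pair_incl P) (absDH_DH n P x) =
  homology_map (quot_proj (cubes_map (sub_incl P))) n x.
Proof.
apply/esym/homology_map_comp => y; apply/esym.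
rewrite [LHS](pair_cubes_mapE (pair_incl P)); apply: congr1.
exact: cubes_map_pair_incl.
Qed.

Lemma DH_map_sub_incl n P x :
  DH_map n (sub_incl P) (absDH_DH n (sub_obj P) x) =
  absDH_DH n P (homology_map (cubes_map (sub_incl P)) n x).
Proof. exact: (absDH_DH_natural (P := sub_obj P)). Qed.

Lemma DH_exact_abs n P :
  exact_at (DH_map n (sub_incl P)) (DH_map n (pair_incl P)).
Proof.
(* The third column is the identity, as [DH n P] is by definition the homology of the quotient
   complex. *)
apply: (exact_at_bij (w := idfun) (@DH_map_sub_incl n P)
  (@DH_map_pair_incl n P)) => //; try exact: absDH_DH_bij.
exact/exact_quot_middle/sub_cubes_map_inj.
Qed.

Lemma DH_exact_pair n P :
  exact_at (DH_map n.+1 (pair_incl P)) (DH_conn n P).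
Proof.
(* The ascription replaces the codomain [DH n (abs_obj (sub_obj P))] by the convertible
   [DH n (sub_obj P)]. *)
pose w : {additive absDH n (sub_obj P) -> DH n (sub_obj P)} :=
  absDH_DH n (sub_obj P).
apply: (exact_at_bij (g' := DH_conn n P) (v := id) (w := w)
  (@DH_map_pair_incl n.+1 P) (fun=> erefl)).
- exact: absDH_DH_bij.
- by exists id.
- exact: bij_inj (absDH_DH_bij n (sub_obj P)).
- exact: exact_quot_right.
Qed.

Lemma DH_exact_sub n P : exact_at (DH_conn n P) (DH_map n (sub_incl P)).
Proof.
pose v : {additive absDH n (sub_obj P) -> DH n (sub_obj P)} :=
  absDH_DH n (sub_obj P).
apply: (exact_at_bij (f := connecting (@sub_cubes_map_inj R P) n)
  (f' := DH_conn n P) (u := id) (v := v) (fun=> erefl) (@DH_map_sub_incl n P)).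
- by exists id.
- exact: (absDH_DH_bij n (sub_obj P)).
- exact: bij_inj (absDH_DH_bij n P).
- exact: exact_quot_left.
Qed.

Lemma DH0_pair_incl_surj P (y : DH 0 P) : exists x, DH_map 0 (pair_incl P) x = y.
Proof.
have [x <-] := homology_quot_proj0_surj y.
by exists (absDH_DH 0 P x); exact: DH_map_pair_incl.
Qed.

End Functoriality.

(** * Additive maps defined on cubes, and cubes with values in a subset *)

Section FreeCubes.
Variables (R : realType) (X : metricType R) (r : R) (n : nat) (M : zmodType).
Variable (F : cube X r n -> M).
Hypothesis F_degenerate : forall s, degenerate s -> F s = 0.

Let lift0 x : @degenerate_chains _ _ _ n x -> free_lift F x = 0.
Proof. by move=> [s ds ->]; rewrite free_liftU F_degenerate. Qed.

Definition cubes_lift : {additive cubes X r n -> M} := qlift lift0.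

Lemma cubes_liftE s : cubes_lift (cube_class s) = F s.
Proof. by rewrite [LHS](qliftE lift0) free_liftU. Qed.

End FreeCubes.

Lemma cube_class_degenerate (R : realType) (X : metricType R) (r : R) n
    (s : cube X r n) :
  degenerate s -> cube_class s = 0.
Proof. by move=> ds; apply/qproj_eq0/generated_sub; exists s. Qed.

Section RestrictCube.
Variables (R : realType) (X : metricType R) (B : set X) (r : R) (n : nat).
Variables (s : cube X r n) (sB : forall a, B (s a)).

Let restrict_is_cube :
  is_cube r [ffun a => SigSub (mem_set (sB a)) : B].
Proof.
by apply/asboolP => x y; rewrite !ffunE; have /asboolP := cubeP s; apply.
Qed.

Definition restrict_cube : cube B r n := Cube restrict_is_cube.

Lemma restrict_cubeE a : val (restrict_cube a) = s a.
Proof. by rewrite ffunE. Qed.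

End RestrictCube.

Lemma degenerate_restrict_cube (R : realType) (X : metricType R) (B : set X)
    (r : R) n (s : cube X r n) (sB : forall a, B (s a)) :
  degenerate s -> degenerate (restrict_cube sB).
Proof.
case: n s sB => // n s sB [i si]; exists i.
apply: val_inj; apply/ffunP => a; apply: val_inj.
rewrite !faceE !restrict_cubeE -!faceE.
exact: (congr1 (fun t : cube _ _ _ => t a) si).
Qed.

(** * Relative chains and the dimension axiom *)

Section Pairs.
Variable R : realType.
Implicit Types P Q : met R.

Lemma sub_incl_restrict P n
    (s : cube (met_space P) (met_scale P)%:num n)
    (sA : forall a, met_sub P (s a)) :
  cube_comp (sub_incl P) (restrict_cube sA) = s.
Proof.
by apply: val_inj; apply/ffunP => a; rewrite ffunE -[RHS](restrict_cubeE sA).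
Qed.

Lemma quot_proj_in_sub P n (s : cube (met_space P) (met_scale P)%:num n) :
  (forall a, met_sub P (s a)) ->
  quot_proj (cubes_map (sub_incl P)) n (cube_class s) = 0.
Proof.
move=> sA; apply/quot_proj_eq0; exists (cube_class (restrict_cube sA)).
by rewrite cubes_mapE; congr cube_class; exact: sub_incl_restrict.
Qed.

Lemma pair_cubes_ind P n (H : pair_cubes P n -> Prop) :
  is_subgroup [set x | H x] ->
  (forall s, H (quot_proj (cubes_map (sub_incl P)) n (cube_class s))) ->
  forall x, H x.
Proof.
move=> [H0 HB] Hs x; have [t <-] := quot_proj_surj x.
elim/cubes_ind: t => [|s]; last exact: Hs.
by split=> [|y z]; rewrite /mkset ?raddf0 // raddfB; exact: HB.
Qed.

(** Cubes of positive dimension in a point have equal opposite faces, hence are degenerate: the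
    chain groups themselves vanish in positive degrees. *)
Lemma DH_point_eq0 (T : metricType R) (p : T) (r : {posnum R}) n :
  (forall x : T, x = p) -> (1 <= n)%N ->
  forall x : DH n (Met (set0 : set T) r), x = 0.
Proof.
move=> Tp; case: n => // n _ x.
have chain0 (y : pair_cubes (Met (set0 : set T) r) n.+1) : y = 0.
  elim/pair_cubes_ind: y => [|s].
    by split=> [//|y y']; rewrite /mkset => -> ->; rewrite subr0.
  rewrite cube_class_degenerate ?raddf0 //; exists ord0.
  by apply: val_inj; apply/ffunP => a; rewrite [LHS]Tp [RHS]Tp.
have [z <-] := hclass_surj x.
by apply/hclass_eq0; exists 0; rewrite raddf0 [RHS]chain0.
Qed.

End Pairs.

(** * Excision *)

Section Excision.
Variables (R : realType) (X : metricType R) (A B : set X) (r : {posnum R}).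

Let PB : met R := Met (met_space := B) (val @^-1` A) r.
Let PX : met R := Met A r.
Let proj n := quot_proj (cubes_map (sub_incl PX)) n.
Let projB n := quot_proj (cubes_map (sub_incl PB)) n.
Let incl := pair_cubes_map (excision_incl A B r).

(* Discarding the cubes outside [B] gives the inverse of the inclusion on
   chains; it need not be checked to commute with the boundary. *)
Let retract_cube n (s : cube X r%:num n) : pair_cubes PB n :=
  if pselect (forall a, B (s a)) is left sB
  then projB n (cube_class (restrict_cube sB)) else 0.

Let retract_degenerate n s : degenerate s -> @retract_cube n s = 0.
Proof.
move=> ds; rewrite /retract_cube; case: pselect => // sB.
by rewrite cube_class_degenerate ?raddf0 //; exact: degenerate_restrict_cube.
Qed.

Let retract_abs n : {additive abs_cubes PX n -> pair_cubes PB n} :=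
  cubes_lift (@retract_degenerate n).

(** A cube in [A] either leaves [B] and is discarded, or restricts to a cube in the intersection,
    which is zero in the relative chains of [B]. *)
Let retract_abs0 n x : range (cubes_map (sub_incl PX) n) x -> retract_abs n x = 0.
Proof.
move=> [a _ <-]; elim/cubes_ind: a => [|s].
  split=> [|y z]; rewrite /mkset ?raddf0 // => hy hz.
  by rewrite !raddfB hy hz subr0.
rewrite cubes_mapE [LHS]cubes_liftE /retract_cube; case: pselect => // sB.
apply: quot_proj_in_sub => a.
rewrite -[met_sub PB _]/(A (val (restrict_cube sB a))) restrict_cubeE ffunE.
exact/set_mem/(valP (s a)).
Qed.

Let retract n : {additive pair_cubes PX n -> pair_cubes PB n} :=
  qlift (@retract_abs0 n).

Let retractE n s : retract n (proj n (cube_class s)) = retract_cube s.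
Proof. by rewrite [LHS](qliftE (@retract_abs0 n)) [LHS]cubes_liftE. Qed.

Let inclE n s : incl n (projB n (cube_class s)) =
  proj n (cube_class (cube_comp (excision_incl A B r) s)).
Proof. by rewrite [LHS](pair_cubes_mapE (excision_incl A B r)) cubes_mapE. Qed.

Let inclK n : cancel (incl n) (retract n).
Proof.
move=> x; elim/pair_cubes_ind: x => [|s].
  split=> [|y z]; rewrite /mkset ?raddf0 // => hy hz.
  by rewrite !raddfB hy hz.
rewrite inclE retractE /retract_cube; case: pselect => [sB|[]a]; last first.
  by rewrite ffunE; exact/set_mem/(valP (s a)).
congr (projB n (cube_class _)); apply: val_inj; apply/ffunP => a.
by apply: val_inj; rewrite restrict_cubeE ffunE.
Qed.

Hypothesis cover : discrete_cover r%:num (fun b : bool => if b then A else B).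

Let retractK n : cancel (retract n) (incl n).
Proof.
move=> x; elim/pair_cubes_ind: x => [|s].
  split=> [|y z]; rewrite /mkset ?raddf0 // => hy hz.
  by rewrite !raddfB hy hz.
rewrite retractE /retract_cube; case: pselect => [sB|nB].
  rewrite inclE; congr (proj n (cube_class _)); apply: val_inj.
  by apply/ffunP => a; rewrite ffunE -[RHS](restrict_cubeE sB).
(* The cube is not contained in [B]. If degenerate it is zero; otherwise the cover puts it in [A],
   where it is zero as a relative chain. *)
rewrite raddf0; apply/esym.
have [ds|/(cover.2)[[] sA]] := pselect (degenerate s).
- by rewrite cube_class_degenerate // raddf0.
- exact: quot_proj_in_sub.
- by case: nB.
Qed.

Lemma DH_excision n : bijective (DH_map n (excision_incl A B r)).
Proof.
apply: homology_map_bij => m.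
by exists (retract m); [exact: inclK | exact: retractK].
Qed.

End Excision.

(** * Splitting off the first coordinate of a cube *)

Definition vertex_tail n (v : vertex n.+1) : vertex n :=
  [ffun j => v (fintype.lift ord0 j)].

Lemma hamming_sym n (v w : vertex n) : hamming v w = hamming w v.
Proof. by apply: eq_card => i; rewrite !inE eq_sym. Qed.

Lemma hamming_tail n (v w : vertex n.+1) :
  hamming v w = ((v ord0 != w ord0) + hamming (vertex_tail v) (vertex_tail w))%N.
Proof.
rewrite /hamming -!sum1_card big_mkcond [X in (_ + X)%N]big_mkcond /=.
rewrite (bigD1_ord ord0) //= inE; congr addn.
by apply: eq_bigr => j _; rewrite !inE !ffunE.
Qed.

Lemma tail_insert0 n b (v : vertex n) : vertex_tail (insert ord0 b v) = v.
Proof. by apply/ffunP => j; rewrite !ffunE liftK. Qed.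

Lemma insert0E n b (v : vertex n) : insert ord0 b v ord0 = b.
Proof. by rewrite ffunE unlift_none. Qed.

Lemma lift_lift0 n (i : 'I_n.+1) (j : 'I_n) :
  fintype.lift (fintype.lift ord0 i) (fintype.lift ord0 j) =
  fintype.lift ord0 (fintype.lift i j).
Proof. by apply: val_inj; rewrite /= /bump /= !add1n ltnS addnS. Qed.

Lemma lift_ord0 n (i : 'I_n.+1) :
  fintype.lift (fintype.lift ord0 i) ord0 = ord0.
Proof. exact: val_inj. Qed.

(** This is what makes the side faces of a prism the prisms over the faces of its base. *)
Lemma tail_insert_lift n (i : 'I_n.+1) b (v : vertex n.+1) :
  vertex_tail (insert (fintype.lift ord0 i) b v) = insert i b (vertex_tail v).
Proof.
apply/ffunP => j; rewrite !ffunE; case: (unliftP i j) => [k|] ->.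
  by rewrite -lift_lift0 liftK ffunE.
by rewrite unlift_none.
Qed.

Lemma insert_lift_ord0 n (i : 'I_n.+1) b (v : vertex n.+1) :
  insert (fintype.lift ord0 i) b v ord0 = v ord0.
Proof. by rewrite ffunE -{2}(lift_ord0 i) liftK. Qed.

(** The signs become integer multiples, since the quotient chain groups carry only a [zmodType]
    structure. *)
Lemma cubes_bd_sum (R : realType) (X : metricType R) (r : R) n
    (s : cube X r n.+1) :
  cbd (cube_class s) =
  \sum_(i < n.+1)
    (cube_class (face i false s) - cube_class (face i true s)) *~ (-1) ^+ i.+1.
Proof.
rewrite cubes_bd /boundary raddf_sum; apply: eq_bigr => i _.
rewrite -signr_odd scaler_sign; case: odd.
  by rewrite mulrN1z raddfN raddfB.
by rewrite mulr1z raddfB.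
Qed.

(** * Prisms and homotopy invariance *)

Section Prism.
Variables (R : realType) (P Q : met R) (f g : metmor P Q).
Hypothesis fg_close : forall x y,
  mdist (f x) (g y) <= (mfactor f)%:num * (mdist x y + (met_scale P)%:num).

Let cubeP_ n := cube (met_space P) (met_scale P)%:num n.
Let cubeQ_ n := cube (met_space Q) (met_scale Q)%:num n.

Let prism_fun n (s : cubeP_ n) : {ffun vertex n.+1 -> met_space Q} :=
  [ffun v : vertex n.+1 => (if v ord0 then g else f) (s (vertex_tail v))].

(** On each end the prism is [f] or [g] composed with [s]. Between the ends the extra coordinate
    adds 1 to the Hamming distance, which allows one more target scale, that is [mfactor f] times
    the source scale: exactly the slack in [fg_close]. *)
Let prism_is_cube n (s : cubeP_ n) : is_cube (met_scale Q)%:num (prism_fun s).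
Proof.
apply/asboolP => x y; rewrite !ffunE hamming_tail.
have cross (u v : vertex n) : mdist (f (s u)) (g (s v)) <=
    (met_scale Q)%:num * (1 + hamming u v)%N%:R.
  apply: (le_trans (fg_close _ _)).
  rewrite (mfun_scale f) -mulrA ler_pM2l // natrD mulrDr mulr1 addrC lerD2l.
  by have /asboolP := cubeP s; apply.
case: (x ord0) (y ord0) => -[] //=.
- have /asboolP/(_ (vertex_tail x) (vertex_tail y)) := cubeP (cube_comp g s).
  by rewrite /= !ffunE.
- by rewrite metric_sym hamming_sym cross.
- have /asboolP/(_ (vertex_tail x) (vertex_tail y)) := cubeP (cube_comp f s).
  by rewrite /= !ffunE.
Qed.

Definition prism n (s : cubeP_ n) : cubeQ_ n.+1 := Cube (prism_is_cube s).

Lemma face0_prism n (s : cubeP_ n) b :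
  face ord0 b (prism s) = cube_comp (if b then g else f) s.
Proof.
apply: val_inj; apply/ffunP => a.
by rewrite faceE [LHS]ffunE tail_insert0 insert0E [RHS]ffunE; case: b.
Qed.

Lemma face_lift_prism n (s : cubeP_ n.+1) i b :
  face (fintype.lift ord0 i) b (prism s) = prism (face i b s).
Proof.
apply: val_inj; apply/ffunP => a.
by rewrite faceE [LHS]ffunE tail_insert_lift insert_lift_ord0 [RHS]ffunE faceE.
Qed.

(** Degeneracy persists in the shifted direction, so prisms are defined modulo degenerate cubes. *)
Lemma degenerate_prism n (s : cubeP_ n) : degenerate s -> degenerate (prism s).
Proof.
case: n s => // n s [i si]; exists (fintype.lift ord0 i).
by rewrite !face_lift_prism si.
Qed.

Let prism_class0 n (s : cubeP_ n) : degenerate s -> cube_class (prism s) = 0.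
Proof. by move=> ds; exact/cube_class_degenerate/degenerate_prism. Qed.

Definition prism_chain n : {additive abs_cubes P n -> abs_cubes Q n.+1} :=
  cubes_lift (@prism_class0 n).

Lemma prism_chainE n (s : cubeP_ n) :
  prism_chain n (cube_class s) = cube_class (prism s).
Proof. exact: cubes_liftE. Qed.

(** The extra direction comes first, with sign -1, and its two faces give [g - f]. Every other
    direction is shifted by one, which flips its sign and accounts for the minus before the prism of
    [cbd x]. *)
Lemma prism_chain_bd n (x : abs_cubes P n.+1) :
  cbd (prism_chain n.+1 x) =
  cubes_map g n.+1 x - cubes_map f n.+1 x - prism_chain n (cbd x).
Proof.
elim/cubes_ind: x => [|s].
  split=> [|x y]; rewrite /mkset ?raddf0 ?addr0 // => hx hy.
  rewrite !raddfB hx hy !raddfB [LHS]addrACA.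
  by congr (_ + _); exact: addrACA.
rewrite prism_chainE !cubes_mapE !cubes_bd_sum big_ord_recl !face0_prism.
rewrite expr1 mulrN1z opprB; apply: (congr1 (+%R _)).
rewrite raddf_sum -sumrN; apply: eq_bigr => i _.
rewrite raddfMz raddfB !prism_chainE !face_lift_prism /=.
by rewrite [in LHS]exprS mulN1r mulrNz.
Qed.

Lemma prism_chain_bd0 (x : abs_cubes P 0) :
  cbd (prism_chain 0 x) = cubes_map g 0 x - cubes_map f 0 x.
Proof.
elim/cubes_ind: x => [|s].
  split=> [|x y]; rewrite /mkset ?raddf0 ?addr0 // => hx hy.
  by rewrite !raddfB hx hy !raddfB; exact: addrACA.
rewrite prism_chainE !cubes_mapE cubes_bd_sum big_ord_recl big_ord0 addr0.
by rewrite !face0_prism expr1 mulrN1z opprB.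
Qed.

Lemma prism_chain_sub n a :
  quot_proj (cubes_map (sub_incl Q)) n.+1
    (prism_chain n (cubes_map (sub_incl P) n a)) = 0.
Proof.
elim/cubes_ind: a => [|s].
  split=> [|y z]; rewrite /mkset ?raddf0 // => hy hz.
  by rewrite !raddfB hy hz subr0.
rewrite cubes_mapE [prism_chain _ _]prism_chainE.
apply: quot_proj_in_sub => a; rewrite /= ffunE.
have sA v : met_sub P (cube_comp (sub_incl P) s v).
  by rewrite ffunE; exact/set_mem/(valP (s v)).
by case: ifP => _; apply: mfun_sub; exact: sA.
Qed.

Lemma DH_map_close n x : DH_map n f x = DH_map n g x.
Proof.
apply: (homology_quot_homotopic (h := prism_chain)).
- exact: prism_chain_bd0.
- exact: prism_chain_bd.
- exact: prism_chain_sub.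
Qed.

End Prism.

(** Each time slice of [F] is a morphism with the factor of [f], and neighbouring slices satisfy
    [fg_close]; induction on time then links [f] to [g]. *)
Lemma DH_map_homotopic (R : realType) (P Q : met R) (f g : metmor P Q) :
  1 <= (met_scale P)%:num ->
  discrete_homotopic (mfactor f)%:num (met_sub P) (met_sub Q) f g ->
  forall n x, DH_map n f x = DH_map n g x.
Proof.
move=> scale_ge1 [m [F [F_lip F0 Fm F_sub]]] n x.
have stage_lip i : lipschitz (@mdist R _) (@mdist R _) (mfactor f)%:num
    (fun x => F (x, i)).
  move=> u v; apply: (le_trans (F_lip _ _)).
  by rewrite /= subrr normr0 addr0.
pose stage i := MetMor (stage_lip i) (fun x => F_sub x i) (mfun_scale f).
have stepE (i : nat) (lt_i : (i < m.+1)%N) :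
    DH_map n f x = DH_map n (stage (Ordinal lt_i)) x.
  elim: i lt_i => [|i IH] lt_i.
    by apply: DH_map_ext => u /=; rewrite -F0; congr (F (_, _)); exact: val_inj.
  rewrite (IH (ltnW lt_i)); apply: DH_map_close => u v.
  (* Consecutive times are at distance 1, so the bound required by [fg_close] reduces to [1 <= r]
     for the source scale [r]. *)
  apply: (le_trans (F_lip _ _)); rewrite ler_pM2l //= lerD2l.
  by rewrite -natr1 opprD addrA subrr sub0r normrN1.
rewrite (stepE m (ltnSn m)); apply: DH_map_ext => u /=; rewrite -Fm.
by congr (F (_, _)); exact: val_inj.
Qed.

Theorem theorem1p1 (R : realType) :
  (* each DH_n is a functor *)
  (forall (n : nat) (P : met R) (x : DH n P), DH_map n (met_id P) x = x) /\
  (forall (n : nat) (P Q S : met R) (g : metmor Q S) (f : metmor P Q)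
     (x : DH n P),
     DH_map n (met_comp g f) x = DH_map n g (DH_map n f x)) /\
  (* the connecting map is natural *)
  (forall (n : nat) (P Q : met R) (f : metmor P Q) (x : DH n.+1 P),
     DH_conn n Q (DH_map n.+1 f x) =
     DH_map n (met_restrict f) (DH_conn n P x)) /\
  (* homotopy; false in general for scales [r < 1] *)
  (forall (P Q : met R) (f g : metmor P Q),
     1 <= (met_scale P)%:num ->
     mfactor f = mfactor g ->
     discrete_homotopic (mfactor f)%:num (met_sub P) (met_sub Q) f g ->
     forall (n : nat) (x : DH n P), DH_map n f x = DH_map n g x) /\
  (* excision *)
  (forall (X : metricType R) (A B : set X) (r : {posnum R}),
     discrete_cover r%:num (fun b : bool => if b then A else B) ->
     forall n : nat, bijective (DH_map n (excision_incl A B r))) /\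
  (* dimension *)
  (forall (T : metricType R) (p : T) (r : {posnum R}),
     (forall x : T, x = p) ->
     forall n : nat, (1 <= n)%N ->
     forall x : DH n (Met (set0 : set T) r), x = 0) /\
  (* long exact sequence *)
  (forall (P : met R),
     (forall n : nat,
        exact_at (DH_map n (sub_incl P)) (DH_map n (pair_incl P)) /\
        exact_at (DH_map n.+1 (pair_incl P)) (DH_conn n P) /\
        exact_at (DH_conn n P) (DH_map n (sub_incl P))) /\
     (forall y : DH 0 P, exists x, DH_map 0 (pair_incl P) x = y)).
Proof.
split=> [n P x|]; first exact: DH_map_id.
split=> [n P Q S g f x|]; first exact: DH_map_comp.
split=> [n P Q f x|]; first exact: DH_conn_natural.
split=> [P Q f g r1 _ fg n x|]; first exact: DH_map_homotopic.
split=> [X A B r AB n|]; first exact: DH_excision.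
split=> [T p r Tp n n1 x|P]; first exact: DH_point_eq0 Tp n1 x.
split=> [n|y]; last exact: DH0_pair_incl_surj.
split; first exact: DH_exact_abs.
by split; [exact: DH_exact_pair | exact: DH_exact_sub].
Qed.
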